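(* Let $J:=\left\lceil\frac1\gamma\right\rceil$ and $\alpha_n:=\frac{1}{\gamma(n+J)}$ for $n\in\mathbb{N}$. Put $Q:=\max\{J(b_A-1)-1,0\}$ and let $K\in\mathbb{N}^*$ with $K\ge\max\left\{\|x_Q-p\|,\frac{\|u-Ap\|}{\gamma}\right\}$. Then each of the following two functions is a rate of $(\tilde T_n)$-asymptotic regularity for $(x_n)$: $$\Phi^*(k)=\max\bigl\{4K(l+1)(k+1)\bigl(\psi(2(l+1)(k+1)-1)+J-1\bigr)-J-l,\ J((b_A+1)K(l+1)(k+1)-1)-1,\ Q+1\bigr\},$$ with $\psi(k)=\max\left\{l\left\lceil\frac{(b_A+1)K}{\gamma}\right\rceil(k+1)-J-Q-1,0\right\}$; and $$\tilde\Phi^*(k)=4K\bigl(2lJ(b_A+1)K(l+1)(k+1)-1\bigr)(l+1)(k+1)-J.$$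
   Context: $\mathbb{N}=\{0,1,2,\dots\}$, $\mathbb{N}^*=\mathbb{N}\setminus\{0\}$; subtractions are in $\mathbb{Z}$. $\phi:\mathbb{N}\to\mathbb{N}$ is a rate of $(\tilde T_n)$-asymptotic regularity of $(x_n)$ if $\forall k\in\mathbb{N}\,\forall n\ge\phi(k)$: $\|x_n-\tilde T_nx_n\|\le\frac1{k+1}$. Setting: $H$ is a real Hilbert space; $A$ is a self-adjoint bounded linear operator on $H$ with $\langle Ax,x\rangle\ge\gamma\|x\|^2$ for all $x\in H$, where $0<\gamma\le1$. $l\in\mathbb{N}$, $l\ge1$, and $T_0,\dots,T_{l-1}:H\to H$ are nonexpansive with $F:=\bigcap_{i=0}^{l-1}\mathrm{Fix}(T_i)\ne\emptyset$; for $n\ge l$, $T_n:=T_{n\bmod l}$; $\tilde T_i:=T_{i+l}\cdots T_{i+1}$ (composition) for $i\in\mathbb{N}$. $u\in H$, and $(x_n)$ is Xu's iteration associated with $(\alpha_n)$: $x_0\in H$, $x_{n+1}=(I-\alpha_{n+1}A)T_{n+1}x_n+\alpha_{n+1}u$. Take $p\in F$ and $b_A\in\mathbb{N}^*$ with $b_A\ge\|A\|$. *)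

(* Defs.v *)
From HB Require Import structures.
From mathcomp Require Import all_boot all_order all_algebra.
From mathcomp Require Import all_classical all_reals all_analysis.

Set Implicit Arguments.
Unset Strict Implicit.
Unset Printing Implicit Defensive.

Import Order.TTheory GRing.Theory Num.Theory.
Import numFieldNormedType.Exports.

Local Open Scope classical_set_scope.
Local Open Scope ring_scope.

(* A real Hilbert space is a completeNormedModType over a realType R together
   with a symmetric positive definite form dot : {dot H for idfun} inducing its
   norm. *)
Definition dot_induces_norm (R : realType) (H : normedModType R)
    (dot : {dot H for (@idfun R)}) : Prop :=
  forall x : H, dot x x = `|x| ^+ 2.

Definition self_adjoint (R : realType) (H : normedModType R)
    (dot : {dot H for (@idfun R)}) (A : H -> H) : Prop :=
  forall x y : H, dot (A x) y = dot x (A y).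

(* sup is a genuine supremum only when A is bounded on the unit ball. *)
Definition opnorm (R : realType) (H : normedModType R) (A : H -> H) : R :=
  sup [set `|A x| | x in [set x : H | `|x| <= 1]].

Definition nonexpansive (R : realType) (H : normedModType R) (S : H -> H) :
    Prop :=
  forall x y : H, `|S x - S y| <= `|x - y|.

Definition Fix (H : Type) (S : H -> H) : set H := [set x | S x = x].

(* comp_from T i m = T (i + m) \o ... \o T (i + 1) *)
Fixpoint comp_from (H : Type) (T : nat -> H -> H) (i m : nat) : H -> H :=
  if m is m'.+1 then T (i + m'.+1)%N \o comp_from T i m' else id.

Definition Ttilde (H : Type) (T : nat -> H -> H) (l i : nat) : H -> H :=
  comp_from T i l.

Definition xu_iteration (R : realType) (H : normedModType R) (A : H -> H)
    (T : nat -> H -> H) (u : H) (alpha : nat -> R) (x : nat -> H) : Prop :=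
  forall n : nat,
    x n.+1 = (T n.+1 (x n) - alpha n.+1 *: A (T n.+1 (x n))) + alpha n.+1 *: u.

Definition asymptotic_regularity_rate (R : realType) (H : normedModType R)
    (S : nat -> H -> H) (x : nat -> H) (phi : nat -> nat) : Prop :=
  forall k n : nat, (phi k <= n)%N -> `|x n - S n (x n)| <= 1 / (k%:R + 1).

Definition J (R : realType) (gamma : R) : int := Num.ceil (1 / gamma).

Definition alpha (R : realType) (gamma : R) (n : nat) : R :=
  1 / (gamma * (n%:R + (J gamma)%:~R)).

(* The subtractions below are taken in int. Q is truncated at 0 before absz,
   which is thus the plain cast of a nonnegative integer. *)
Definition Q (R : realType) (gamma : R) (bA : nat) : nat :=
  `|(Num.max (J gamma * (bA%:Z - 1) - 1) 0)%R|%N.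

Definition psi (R : realType) (gamma : R) (bA K l : nat) (k : int) : int :=
  Num.max
    (l%:Z * Num.ceil ((bA%:R + 1) * K%:R / gamma) * (k + 1)
       - J gamma - (Q gamma bA)%:Z - 1)
    0.

Definition PhiStar (R : realType) (gamma : R) (bA K l k : nat) : int :=
  Num.max
    (4 * K%:Z * (l%:Z + 1) * (k%:Z + 1)
       * (psi gamma bA K l (2 * (l%:Z + 1) * (k%:Z + 1) - 1) + J gamma - 1)
       - J gamma - l%:Z)
    (Num.max
       (J gamma * ((bA%:Z + 1) * K%:Z * (l%:Z + 1) * (k%:Z + 1) - 1) - 1)
       ((Q gamma bA)%:Z + 1)).

Definition PhiTildeStar (R : realType) (gamma : R) (bA K l k : nat) : int :=
  4 * K%:Z
    * (2 * l%:Z * J gamma * (bA%:Z + 1) * K%:Z * (l%:Z + 1) * (k%:Z + 1) - 1)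
    * (l%:Z + 1) * (k%:Z + 1)
  - J gamma.

(* Main.v *)
Require Import Defs.
From HB Require Import structures.
From mathcomp Require Import all_boot all_order all_algebra.
From mathcomp Require Import all_classical all_reals all_analysis.
From mathcomp Require Import ring lra zify.

(** Once a ||A|| <= 1, the operator I - a A is positive with norm at most
    1 - a gamma; this applies to a = alpha_n for n > Q, so x_n stays within K
    of p from index Q on and ||u - A T_{n+1} x_n|| <= M := (b_A + 1) K.  Put
    N = n + l + J, c = (b_A + 1) / gamma and P = (l + 1)(k + 1).  The shifted
    difference d_n = ||x_{n+l} - x_n|| satisfies
      (N + 1) d_{n+1} <= N d_n + K c l / (n + 1 + J),
    hence N d_n <= 2 K (m + l + J) + K c l log (N / (m + J)) for m >= Q.  With
    m + J = l J b_A this gives d_n <= 1 / P as soon as N >= 4 K^2 P^2 c l, which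
    both functions guarantee.  The logarithmic estimate leaves enough room to
    absorb the additive terms Q + l + 1 that splitting the product of the
    factors 1 - gamma alpha_i at index Q + psi would leave over in Phi^*.
    Each of the l steps from x_n to x_{n+l} deviates from T_{i+1} by
    alpha_{i+1} M <= 1 / P, and the total is (l + 1) / P = 1 / (k + 1). *)

Set Implicit Arguments.
Unset Strict Implicit.
Unset Printing Implicit Defensive.

Import Order.TTheory GRing.Theory Num.Theory.
Import numFieldNormedType.Exports.

Local Open Scope classical_set_scope.
Local Open Scope ring_scope.

(** * Operator norm, inner product and the contraction property of [I - a A] *)

Lemma le_opnorm (R : realType) (H : normedModType R) (A : {linear H -> H})
    (A_bounded : bounded_near A (nbhs (0 : H))) (x : H) :
  `|A x| <= opnorm A * `|x|.
Proof.
have hs : has_sup [set `|A x| | x in [set x : H | `|x| <= 1]].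
  split; first by exists `|A 0|, 0 => //=; rewrite normr0.
  move/linear_boundedP/pinfty_ex_gt0: A_bounded => [r r0 Ar].
  exists r => _ [y y1 <-]; apply: le_trans (Ar y) _.
  by rewrite ler_piMr // ltW.
have [->|x0] := eqVneq x 0; first by rewrite linear0 !normr0 mulr0.
have nx0 : 0 < `|x| by rewrite normr_gt0.
rewrite -ler_pdivrMr //; apply: (sup_upper_bound hs).
exists (`|x|^-1 *: x); rewrite /=.
  by rewrite normrZ normfV normr_id mulVf // gt_eqF.
by rewrite linearZ normrZ normfV normr_id mulrC.
Qed.

Lemma dotC (R : realType) (H : normedModType R) (dot : {dot H for (@idfun R)})
    (x y : H) : dot x y = dot y x.
Proof. by rewrite hermC expr0 mul1r. Qed.

Lemma dotZl (R : realType) (H : normedModType R) (dot : {dot H for (@idfun R)})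
    (a : R) (x y : H) : dot (a *: x) y = a * dot x y.
Proof. by rewrite linearZl_LR. Qed.

Lemma dotZr (R : realType) (H : normedModType R) (dot : {dot H for (@idfun R)})
    (a : R) (x y : H) : dot x (a *: y) = a * dot x y.
Proof. by rewrite linearZr_LR. Qed.

Lemma dotDl (R : realType) (H : normedModType R) (dot : {dot H for (@idfun R)})
    (x y z : H) : dot (x + y) z = dot x z + dot y z.
Proof. exact: (linearDl dot z x y). Qed.

Lemma dotDr (R : realType) (H : normedModType R) (dot : {dot H for (@idfun R)})
    (x y z : H) : dot z (x + y) = dot z x + dot z y.
Proof. exact: (linearDr dot z x y). Qed.

Lemma dotBl (R : realType) (H : normedModType R) (dot : {dot H for (@idfun R)})
    (x y z : H) : dot (x - y) z = dot x z - dot y z.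
Proof. exact: (linearBl dot z x y). Qed.

Lemma dotBr (R : realType) (H : normedModType R) (dot : {dot H for (@idfun R)})
    (x y z : H) : dot z (x - y) = dot z x - dot z y.
Proof. exact: (linearBr dot z x y). Qed.

(** Expanding [|y - b *: x| ^+ 2 >= 0] gives 2b<y,x> <= |y|^2 + b^2|x|^2 <= 2b^2|x|^2. With y = Ax
    this makes the form of I - aA positive when ab <= 1. *)
Lemma dot_le_of_norm_le (R : realType) (H : normedModType R)
    (dot : {dot H for (@idfun R)}) (hdot : dot_induces_norm dot)
    (b : R) (b_gt0 : 0 < b) (x y : H) :
  `|y| <= b * `|x| -> dot y x <= b * `|x| ^+ 2.
Proof.
move=> yx; have := sqr_ge0 `|y - b *: x|.
rewrite -(hdot (y - _)) dotBl !dotBr !dotZl !dotZr (dotC _ x y) !hdot => h.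
have := normr_ge0 x; have := normr_ge0 y; move: h yx.
set s := `|x|; set t := `|y|; set e := dot y x => h ts t0 s0.
rewrite -(ler_pM2l b_gt0); nra.
Qed.

(* Discriminant argument for the positive form [<(I - aA)., .>], evaluated at
   [x - r^-1 (I - aA)x], where [r = 1 - a gamma]. *)
Lemma norm_I_sub_scale_le (R : realType) (H : normedModType R)
    (dot : {dot H for (@idfun R)}) (hdot : dot_induces_norm dot)
    (A : {linear H -> H}) (A_selfadj : self_adjoint dot A)
    (gamma : R) (A_coercive : forall x : H, gamma * `|x| ^+ 2 <= dot (A x) x)
    (b : R) (b_gt0 : 0 < b) (A_le : forall x : H, `|A x| <= b * `|x|)
    (a : R) (a_ge0 : 0 <= a) (ab_le1 : a * b <= 1) (ag_le1 : a * gamma <= 1)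
    (x : H) :
  `|x - a *: A x| <= (1 - a * gamma) * `|x|.
Proof.
pose B (z : H) := z - a *: A z.
have q_ge0 z : 0 <= dot (B z) z.
  rewrite /B dotBl dotZl hdot.
  have := dot_le_of_norm_le hdot b_gt0 (A_le z); have := sqr_ge0 `|z|; nra.
have q_le z : dot (B z) z <= (1 - a * gamma) * `|z| ^+ 2.
  by rewrite /B dotBl dotZl hdot; have := A_coercive z; nra.
have BE t z : B (x + t *: z) = B x + t *: B z.
  rewrite /B (_ : A (x + t *: z) = A x + t *: A z); last by rewrite linearD linearZ.
  by rewrite scalerDr opprD addrACA [t *: (z - _)]scalerBr !scalerA (mulrC a).
have BC z w : dot (B z) w = dot z (B w).
  by rewrite /B dotBl dotBr dotZl dotZr A_selfadj.
rewrite -/(B x); set r := 1 - a * gamma; have r_ge0 : 0 <= r by rewrite /r; lra.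
have disc t : 0 <= r * `|x| ^+ 2 + 2 * t * `|B x| ^+ 2 + t ^+ 2 * (r * `|B x| ^+ 2).
  have := q_ge0 (x + t *: B x); rewrite BE dotDl !dotDr !dotZl !dotZr.
  rewrite (BC (B x) x) hdot.
  by have := q_le x; have := q_le (B x); rewrite -/r; have := sqr_ge0 t; nra.
have [r0|r_neq0] := eqVneq r 0.
  have := disc (-1); rewrite r0 !mul0r => h.
  by have : `|B x| ^+ 2 = 0 by [have := sqr_ge0 `|B x|; lra]; move/eqP; rewrite sqrf_eq0 => /eqP ->.
have r_gt0 : 0 < r by rewrite lt_def r_neq0.
rewrite -ler_sqr ?nnegrE ?mulr_ge0 // exprMn.
have := disc (- r^-1); rewrite sqrrN => h.
have : 0 <= r * (r * `|x| ^+ 2 + 2 * - r^-1 * `|B x| ^+ 2 + r^-1 ^+ 2 * (r * `|B x| ^+ 2)).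
  by rewrite mulr_ge0.
suff -> : r * (r * `|x| ^+ 2 + 2 * - r^-1 * `|B x| ^+ 2 + r^-1 ^+ 2 * (r * `|B x| ^+ 2))
  = r ^+ 2 * `|x| ^+ 2 - `|B x| ^+ 2 by lra.
by field.
Qed.

(** * Logarithmic estimates *)

Lemma ln_le_tangent (R : realType) (s t : R) (s_gt0 : 0 < s) (t_gt0 : 0 < t) :
  ln t <= ln s + t / s - 1.
Proof.
have ts : 0 < t / s by rewrite divr_gt0.
have -> : ln t = ln s + ln (1 + (t / s - 1)).
  by rewrite -lnM ?posrE; [congr ln; field; rewrite gt_eqF| |lra].
have : ln (1 + (t / s - 1)) <= t / s - 1 by apply: le_ln1Dx; lra.
lra.
Qed.

(** Tangents at 1, 5/4 and 3/2 give 1/4 + 1/5 + 1/3 = 47/60. The value 4/5 is what [log_threshold]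
    needs in its extreme case t = 2. *)
Lemma ln2_le (R : realType) : ln (2 : R) <= 4 / 5.
Proof.
have h (s t : R) : 0 < s -> 0 < t -> ln t <= ln s + t / s - 1 by exact: ln_le_tangent.
have := h 1 (5 / 4) ltac:(lra) ltac:(lra).
have := h (5 / 4) (3 / 2) ltac:(lra) ltac:(lra).
have := h (3 / 2) 2 ltac:(lra) ltac:(lra).
rewrite ln1; lra.
Qed.

(** Put N = 4KPqt, so that t >= KP >= 2 and N/P = 4Kqt. Since N <= 4qt^2 <= 8t^2 a, the claim
    reduces to 4 + 3 ln 2 + 2 ln t <= 4t, and the tangent of ln at 2 reduces this to 2 + 5 ln 2 <=
    3t. *)
Lemma log_threshold (R : realType) (K P q a N : R)
    (K_ge1 : 1 <= K) (P_ge2 : 2 <= P) (q_gt0 : 0 < q) (a_ge : q <= 2 * a)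
    (N_ge : 4 * K * P * (K * P * q) <= N) :
  4 * (K * q) + K * q * (ln N - ln a) <= N / P.
Proof.
have a_gt0 : 0 < a by lra.
have K_gt0 : 0 < K by lra.
have P_gt0 : 0 < P by lra.
pose t := N / (4 * K * P * q).
have d_gt0 : 0 < 4 * K * P * q by rewrite !mulr_gt0.
have NE : N = 4 * K * P * q * t by rewrite /t mulrC divfK // gt_eqF.
have KP_t : K * P <= t by rewrite /t ler_pdivlMr // mulrC; apply: le_trans N_ge; nra.
clearbody t; have t_ge2 : 2 <= t by nra.
have t_gt0 : 0 < t by lra.
have N_gt0 : 0 < N by rewrite NE mulr_gt0 //; lra.
have Na : N <= 2 ^+ 3 * t ^+ 2 * a.
  apply: (@le_trans _ _ (4 * q * t * t)).
    rewrite NE (_ : _ * t = 4 * q * t * (K * P)); last by ring.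
    by apply: ler_wpM2l => //; rewrite !mulr_ge0 // ltW.
  have -> : 4 * q * t * t = t ^+ 2 * (4 * q) by ring.
  have -> : 2 ^+ 3 * t ^+ 2 * a = t ^+ 2 * (8 * a) by ring.
  by rewrite ler_wpM2l ?sqr_ge0 //; lra.
have ln2_45 := ln2_le R.
have lnt : ln t <= ln 2 + t / 2 - 1 by apply: ln_le_tangent.
have lnN : ln N <= 3 * ln 2 + 2 * ln t + ln a.
  rewrite mulr_natl -lnXn // mulr_natl -lnXn //.
  rewrite -!lnM ?posrE ?mulr_gt0 ?exprn_gt0 //.
  by rewrite ler_ln ?posrE ?mulr_gt0 ?exprn_gt0.
have -> : N / P = K * q * (4 * t) by rewrite NE; field; rewrite gt_eqF.
have Kq : 0 < K * q by rewrite mulr_gt0.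
have : 4 + (ln N - ln a) <= 4 * t by lra.
by rewrite -(ler_pM2l Kq); lra.
Qed.

(** The weighted sequence grows by at most D/(n+j+1) per step, and 1/(n+j+1) <= ln(n+j+1) - ln(n+j)
    by the tangent at n+j+1; the logarithms telescope. *)
Lemma log_growth (R : realType) (d : nat -> R) (m l j : nat) (D : R)
    (D_ge0 : 0 <= D) (mj_gt0 : (0 < m + j)%N)
    (d_rec : forall n, (m <= n)%N ->
       (n + l + j).+1%:R * d n.+1 <= (n + l + j)%:R * d n + D / (n + j).+1%:R)
    (n : nat) (mn : (m <= n)%N) :
  (n + l + j)%:R * d n
    <= (m + l + j)%:R * d m + D * (ln (n + j)%:R - ln (m + j)%:R).
Proof.
elim: n mn => [|n IH].
  by rewrite leqn0 => /eqP ->; rewrite subrr mulr0 addr0.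
rewrite leq_eqVlt => /predU1P[<-|]; first by rewrite subrr mulr0 addr0.
rewrite ltnS => mn; rewrite !addSn; apply: le_trans (d_rec n mn) _.
have nj : 0 < (n + j)%:R :> R by rewrite ltr0n; lia.
have nj1 : 0 < (n + j).+1%:R :> R by rewrite ltr0n.
have := ln_le_tangent nj1 nj.
have -> : (n + j)%:R / (n + j).+1%:R = 1 - (n + j).+1%:R^-1 :> R.
  have -> : (n + j)%:R = (n + j).+1%:R - 1 :> R by rewrite -natr1; lra.
  by rewrite mulrBl divff ?mul1r // gt_eqF.
move: (IH mn); move: (ln (n + j)%:R) (ln (n + j).+1%:R) => a0 a1 Hn h.
have : D / (n + j).+1%:R <= D * (a1 - a0).
  by apply: ler_wpM2l => //; move: h; move: (_^-1) => i h; lra.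
move=> /(lerD Hn) /le_trans; apply; rewrite -addrA -mulrDr.
by rewrite [_ - _ + _]addrC addrA subrK.
Qed.

(** * Boundedness, residuals and shifted differences of Xu's iteration *)

(** With z = T_{n+1} x_n - p, the difference x_{n+1} - p is (I - aA)z + a(u - Ap), whose norm is at
    most the convex combination (1 - a gamma)K + a gamma K = K. *)
Lemma xu_bounded (R : realType) (H : normedModType R) (A : {linear H -> H})
    (T : nat -> H -> H) (u : H) (al : nat -> R) (x : nat -> H)
    (x_xu : xu_iteration A T u al x)
    (T_nonexp : forall i, nonexpansive (T i))
    (p : H) (T_fix : forall i, T i p = p)
    (gamma K : R) (q : nat)
    (al_ge0 : forall n, 0 <= al n) (al_le : forall n, al n * gamma <= 1)
    (contr : forall n, (q < n)%N -> forall z : H,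
       `|z - al n *: A z| <= (1 - al n * gamma) * `|z|)
    (u_le : `|u - A p| <= gamma * K) (xq_le : `|x q - p| <= K)
    (n : nat) (qn : (q <= n)%N) :
  `|x n - p| <= K.
Proof.
elim: n qn => [|n IH]; first by rewrite leqn0 => /eqP <-.
rewrite leq_eqVlt => /predU1P[<-//|qn].
set z := T n.+1 (x n) - p.
have zK : `|z| <= K by rewrite /z -{1}(T_fix n.+1) (le_trans (T_nonexp _ _ _)) // IH.
have -> : x n.+1 - p = (z - al n.+1 *: A z) + al n.+1 *: (u - A p).
  rewrite x_xu /z linearB !scalerBr !opprD !opprK !addrA.
  by rewrite [RHS](ACl ((1*3*5*2)*(4*6))) /= subrr addr0.
apply: (le_trans (ler_normD _ _)); rewrite normrZ ger0_norm //.
have := contr n.+1 qn z; have := ler_wpM2l (al_ge0 n.+1) u_le.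
have := al_le n.+1; nra.
Qed.

Lemma xu_residual (R : realType) (H : normedModType R) (A : {linear H -> H})
    (T : nat -> H -> H) (u : H) (al : nat -> R) (x : nat -> H)
    (x_xu : xu_iteration A T u al x) (n : nat) :
  x n.+1 - T n.+1 (x n) = al n.+1 *: (u - A (T n.+1 (x n))).
Proof. by rewrite x_xu scalerBr addrAC [_ - _ - _]addrAC subrr add0r addrC. Qed.

Lemma xu_residual_le (R : realType) (H : normedModType R) (A : {linear H -> H})
    (T : nat -> H -> H) (u : H) (x : nat -> H)
    (T_nonexp : forall i, nonexpansive (T i))
    (p : H) (T_fix : forall i, T i p = p)
    (b K g : R) (b_ge0 : 0 <= b) (A_le : forall z : H, `|A z| <= b * `|z|)
    (u_le : `|u - A p| <= g) (n : nat) (xn_le : `|x n - p| <= K) :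
  `|u - A (T n.+1 (x n))| <= g + b * K.
Proof.
have -> : u - A (T n.+1 (x n)) = (u - A p) - A (T n.+1 (x n) - p).
  by rewrite linearB opprB addrA subrK.
apply: (le_trans (ler_normB _ _)); apply: lerD => //.
apply: (le_trans (A_le _)); apply: ler_wpM2l => //.
by rewrite -{1}(T_fix n.+1) (le_trans (T_nonexp _ _ _)).
Qed.

(** By periodicity both steps apply the same map, so the change of step size acts only on u - Av,
    while the rest is I - a'A applied to a difference of values of that map. *)
Lemma xu_shift_le (R : realType) (H : normedModType R) (A : {linear H -> H})
    (T : nat -> H -> H) (u : H) (al : nat -> R) (x : nat -> H)
    (x_xu : xu_iteration A T u al x)
    (T_nonexp : forall i, nonexpansive (T i))
    (l n : nat) (T_per : T (n + l).+1 = T n.+1)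
    (gamma M : R) (al_le1 : al (n + l).+1 * gamma <= 1)
    (contr : forall z : H, `|z - al (n + l).+1 *: A z|
                             <= (1 - al (n + l).+1 * gamma) * `|z|)
    (al_le : al (n + l).+1 <= al n.+1)
    (res_le : `|u - A (T n.+1 (x n))| <= M) :
  `|x (n + l).+1 - x n.+1|
    <= (1 - al (n + l).+1 * gamma) * `|x (n + l)%N - x n|
       + (al n.+1 - al (n + l).+1) * M.
Proof.
set v := T n.+1 (x n) in res_le *; set w := T n.+1 (x (n + l)%N).
set a := al n.+1 in al_le *; set a' := al (n + l).+1 in al_le1 contr al_le *.
have -> : x (n + l).+1 - x n.+1
    = ((w - v) - a' *: A (w - v)) + (a' - a) *: (u - A v).
  rewrite !x_xu T_per -/v -/w -/a -/a' linearB !scalerBr !scalerBl.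
  rewrite !opprD !opprK !addrA.
  by rewrite [RHS](ACl ((1*3*5*2*8*6)*(4*7))) /= subrr addr0.
apply: (le_trans (ler_normD _ _)); rewrite normrZ (distrC a') ger0_norm ?subr_ge0 //.
apply: lerD; last by rewrite ler_wpM2l ?subr_ge0.
apply: le_trans (contr _) _; rewrite ler_wpM2l ?subr_ge0 //.
exact: T_nonexp.
Qed.

(** Nonexpansive maps do not amplify earlier errors, so the one-step deviations simply add up. *)
Lemma comp_from_le (R : realType) (H : normedModType R)
    (T : nat -> H -> H) (T_nonexp : forall i, nonexpansive (T i))
    (x : nat -> H) (e : R) (n : nat)
    (res_le : forall i, (n <= i)%N -> `|x i.+1 - T i.+1 (x i)| <= e) (m : nat) :
  `|x (n + m)%N - comp_from T n m (x n)| <= m%:R * e.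
Proof.
elim: m => [|m IH]; first by rewrite addn0 subrr normr0 mul0r.
rewrite addnS /= addnS -natr1 mulrDl mul1r [leRHS]addrC.
apply: le_trans (ler_distD (T (n + m).+1 (x (n + m)%N)) _ _) _.
apply: lerD; first by rewrite res_le // leq_addr.
exact: le_trans (T_nonexp _ _ _) IH.
Qed.

(** * The integers J and Q as naturals, and the rate under threshold conditions *)

Lemma J_natE (R : realType) (gamma : R) (gamma_gt0 : 0 < gamma)
    (gamma_le1 : gamma <= 1) :
  {j : nat | [/\ J gamma = j%:Z, (0 < j)%N, 1 <= gamma * j%:R
                 & gamma * j%:R <= 1 + gamma]}.
Proof.
have J_gt0 : 0 < J gamma by rewrite /J ceil_gt0 divr_gt0.
exists `|J gamma|%N; have e : J gamma = `|J gamma|%N by rewrite gez0_abs // ltW.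
have er : (`|J gamma|%N)%:R = (J gamma)%:~R :> R by rewrite [in RHS]e.
split=> //; first by rewrite absz_gt0 gt_eqF.
  by rewrite er mulrC -ler_pdivrMr // ceil_ge.
have := ceilB1_lt (1 / gamma); rewrite -/(J gamma) rmorphB /= -er ltrBlDr.
move/ltW; rewrite -(ler_pM2l gamma_gt0) mulrDr mulr1.
by rewrite mulrCA divff ?mulr1 // gt_eqF.
Qed.

(** Truncated subtraction on [nat] does the work of the maximum with 0. *)
Lemma Q_natE (R : realType) (gamma : R) (j b : nat) (JE : J gamma = j%:Z)
    (b_gt0 : (0 < b)%N) : Q gamma b = (j * b - j - 1)%N.
Proof. by rewrite /Q JE; case: b b_gt0 => // b _; lia. Qed.

(** Common core of both rates, which enter only through three thresholds: [qn] places n where the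
    iterates are bounded, [N_ge] controls the shifted difference, [n_ge] controls the step sizes. *)
Lemma xu_rate_core (R : realType) (H : normedModType R) (A : {linear H -> H})
    (gamma : R) (gamma_gt0 : 0 < gamma) (gamma_le1 : gamma <= 1)
    (b : nat) (b_gt0 : (0 < b)%N) (A_le : forall z : H, `|A z| <= b%:R * `|z|)
    (contr : forall a : R, 0 <= a -> a * b%:R <= 1 -> a * gamma <= 1 ->
       forall z : H, `|z - a *: A z| <= (1 - a * gamma) * `|z|)
    (l : nat) (l_gt0 : (0 < l)%N) (T : nat -> H -> H)
    (T_nonexp : forall i, nonexpansive (T i))
    (T_per : forall i, T (i + l)%N = T i)
    (p : H) (T_fix : forall i, T i p = p)
    (u : H) (j : nat) (j_gt0 : (0 < j)%N) (gj_ge1 : 1 <= gamma * j%:R)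
    (gj_le : gamma * j%:R <= 1 + gamma)
    (x : nat -> H)
    (x_xu : xu_iteration A T u (fun n => (gamma * (n + j)%:R)^-1) x)
    (K : nat) (K_gt0 : (0 < K)%N)
    (xq_le : `|x (j * b - j - 1)%N - p| <= K%:R) (u_le : `|u - A p| <= gamma * K%:R)
    (k n : nat) (P : R) (PE : P = (l.+1 * k.+1)%:R)
    (qn : (j * b - j - 1 <= n)%N)
    (N_ge : 4 * K%:R * P * (K%:R * P * ((b%:R + 1) / gamma * l%:R))
              <= (n + l + j)%:R)
    (n_ge : (b%:R + 1) * K%:R * P <= gamma * (n.+1 + j)%:R) :
  `|x n - Ttilde T l n (x n)| <= 1 / (k%:R + 1).
Proof.
set q := (j * b - j - 1)%N in xq_le qn.
set c := (b%:R + 1) / gamma in N_ge.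
pose al (i : nat) : R := (gamma * (i + j)%:R)^-1.
have gam_neq0 : gamma != 0 by rewrite gt_eqF.
have ij_gt0 (i : nat) : 0 < (i + j)%:R :> R by rewrite ltr0n addn_gt0 j_gt0 orbT.
have al_gt0 i : 0 < al i by rewrite invr_gt0 mulr_gt0.
have al_gamma i : al i * gamma = (i + j)%:R^-1.
  by rewrite /al invfM mulrC mulrA divff // mul1r.
have al_le1 i : al i * gamma <= 1.
  by rewrite al_gamma invf_le1 // ler1n addn_gt0 j_gt0 orbT.
have al_anti i i' : (i <= i')%N -> al i' <= al i.
  by move=> ii; rewrite lef_pV2 ?posrE ?mulr_gt0 // ler_pM2l // ler_nat leq_add2r.
(* The strict bound i > q gives i + j >= jb, and gamma j >= 1 then yields [al i * b <= 1]. *)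
have al_contr i : (q < i)%N -> forall z : H, `|z - al i *: A z| <= (1 - al i * gamma) * `|z|.
  move=> qi; apply: contr => //; first exact: ltW.
  rewrite mulrC ler_pdivrMr ?mulr_gt0 // mul1r.
  apply: (@le_trans _ _ (gamma * (j * b)%:R)).
    by rewrite natrM mulrA ler_peMl.
  rewrite ler_pM2l // ler_nat; move: qi; rewrite /q => qi. clear -qi; lia.
have K_ge1 : 1 <= K%:R :> R by rewrite ler1n.
have b_ge1 : 1 <= b%:R :> R by rewrite ler1n.
have l_ge1 : 1 <= l%:R :> R by rewrite ler1n.
have x_le i : (q <= i)%N -> `|x i - p| <= K%:R.
  exact: (xu_bounded x_xu T_nonexp T_fix (fun i => ltW (al_gt0 i)) al_le1 al_contr u_le xq_le).
pose M : R := (b%:R + 1) * K%:R.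
have M_ge0 : 0 <= M by rewrite mulr_ge0 //; lra.
have res_le i : (q <= i)%N -> `|u - A (T i.+1 (x i))| <= M.
  move=> qi; have := xu_residual_le T_nonexp T_fix (ler0n _ b) A_le u_le (x_le i qi).
  move=> /le_trans; apply; rewrite /M mulrDl mul1r [leRHS]addrC lerD2r.
  by rewrite ler_piMl ?ler0n.
have P_ge2 : 2 <= P by rewrite PE ler_nat (@leq_mul 2 1).
have P_gt0 : 0 < P by lra.
have c_gt0 : 0 < c by rewrite divr_gt0 //; lra.
have cl_gt0 : 0 < c * l%:R by rewrite mulr_gt0 //; lra.
pose d i := `|x (i + l)%N - x i|.
pose D := K%:R * (c * l%:R).
have D_ge0 : 0 <= D by rewrite mulr_ge0 // ltW.
have d_rec i : (q <= i)%N ->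
    (i + l + j).+1%:R * d i.+1 <= (i + l + j)%:R * d i + D / (i + j).+1%:R.
  move=> qi.
  have qil : (q < (i + l).+1)%N by rewrite ltnS (leq_trans qi) // leq_addr.
  have iil : (i.+1 <= (i + l).+1)%N by rewrite ltnS leq_addr.
  have h := xu_shift_le x_xu T_nonexp (T_per i.+1) (al_le1 (i + l).+1)
    (al_contr _ qil) (al_anti _ _ iil) (res_le i qi).
  have N_gt0 : 0 < (i + l + j).+1%:R :> R by rewrite ltr0n.
  (* With N = i + l + j, the factor 1 - al gamma is N/(N+1), and the two step sizes differ by
     l/(gamma (i+j+1)(N+1)); multiplying by N+1 gives the right-hand side exactly. *)
  apply: le_trans (ler_wpM2l (ltW N_gt0) h) _.
  rewrite al_gamma /al !addSn -/(d i) /D /c /M.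
  have i_gt0 : 0 < (i + j).+1%:R :> R by rewrite ltr0n.
  have -> : (i + l + j)%:R = (i + l + j).+1%:R - 1 :> R by rewrite -natr1 addrK.
  have -> : l%:R = (i + l + j).+1%:R - (i + j).+1%:R :> R.
    by rewrite -natrB ?ltnS -?addnA ?leq_add2l ?leq_addl // subSS subnDl addnK.
  move: N_gt0 i_gt0; move: (_.+1%:R) (_.+1%:R) => y z y_gt0 z_gt0.
  rewrite le_eqVlt; apply/orP; left; apply/eqP; field.
  by rewrite !gt_eqF.
(* From gamma j <= 1 + gamma <= 2. This makes m + l + j = l(jb + 1) at most 2cl, both for m <= n and
   for the initial term. *)
have jb_le : j%:R * b%:R + 1 <= 2 * c.
  rewrite /c mulrA ler_pdivlMr //; nra.
(* The starting index makes m + j comparable with c l, where the bound of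
   log_growth is nearly minimal, while keeping m >= q. *)
pose m := (l * j * b - j)%N.
have mjE : (m + j = l * j * b)%N by rewrite subnK // -mulnA mulnCA leq_pmulr // muln_gt0 l_gt0.
have mjR : (m + j)%:R = l%:R * (j%:R * b%:R) :> R by rewrite mjE !natrM mulrA.
have mn : (m <= n)%N.
  have : (m + j + l)%:R <= (n + l + j)%:R :> R.
    apply: le_trans N_ge; rewrite natrD mjR.
    apply: (@le_trans _ _ (2 * (c * l%:R))); first by nra.
    have KP_ge1 : 1 <= K%:R * P by nra.
    rewrite (_ : 4 * _ * _ * _ = 4 * (K%:R * P) ^+ 2 * (c * l%:R)); last by ring.
    by rewrite ler_wpM2r ?ltW //; nra.
  by rewrite ler_nat addnAC !leq_add2r.
have qm : (q <= m)%N by rewrite (leq_trans (leq_subr _ _)) // leq_sub2r // -mulnA leq_pmull.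
have d_le : d n <= P^-1.
  have N_gt0 : 0 < (n + l + j)%:R :> R by exact: ij_gt0.
  rewrite -(ler_pM2l N_gt0).
  apply: le_trans (log_growth D_ge0 _ _ mn) _; first by rewrite mjE !muln_gt0 l_gt0 j_gt0.
    by move=> i mi; apply: d_rec; apply: leq_trans mi.
  have ln_le : ln (n + j)%:R <= ln (n + l + j)%:R :> R.
    by rewrite ler_ln ?posrE // ler_nat leq_add2r leq_addr.
  (* Together with m + l + j <= 2cl this bounds the initial term by 4Kcl, the additive term of
     [log_threshold]. *)
  have dm : d m <= 2 * K%:R.
    apply: le_trans (ler_distD p _ _) _; rewrite (distrC p).
    have := x_le m qm; have := x_le (m + l)%N (leq_trans qm (leq_addr l m)); lra.
  (* Here b + 1 <= 2b and gamma j >= 1 give c <= 2jb. *)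
  have a_ge : c * l%:R <= 2 * (m + j)%:R.
    rewrite mjR mulrCA mulrC ler_wpM2l // /c ler_pdivrMr //.
    have : (b%:R + 1) * 1 <= 2 * b%:R * (gamma * j%:R) by apply: ler_pM => //; lra.
    by rewrite mulr1 => /le_trans; apply; rewrite le_eqVlt; apply/orP; left; apply/eqP; ring.
  have := log_threshold K_ge1 P_ge2 cl_gt0 a_ge N_ge; rewrite -/D.
  apply: le_trans.
  have -> : (m + l + j)%:R = (m + j)%:R + l%:R :> R by rewrite -natrD addnAC.
  apply: lerD; last by rewrite ler_wpM2l // lerD2r.
  rewrite mjR (_ : _ + l%:R = l%:R * (j%:R * b%:R + 1)); last by ring.
  rewrite (_ : 4 * D = l%:R * (2 * c) * (2 * K%:R)); last by rewrite /D; ring.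
  by apply: ler_pM => //; [exact: normr_ge0 | rewrite ler_wpM2l].
have step_le i : (n <= i)%N -> `|x i.+1 - T i.+1 (x i)| <= P^-1.
  move=> ni; rewrite (xu_residual x_xu) normrZ (ger0_norm (ltW (al_gt0 i.+1))).
  apply: (@le_trans _ _ (al i.+1 * M)).
    by rewrite ler_wpM2l ?(ltW (al_gt0 _)) // res_le // (leq_trans qn).
  rewrite mulrC ler_pdivrMr ?mulr_gt0 // [leRHS]mulrC ler_pdivlMr //.
  apply: (le_trans n_ge); rewrite ler_pM2l // ler_nat leq_add2r.
  exact: ni.
apply: le_trans (ler_distD (x (n + l)%N) _ _) _; rewrite distrC -/(d n).
apply: le_trans (lerD d_le (comp_from_le T_nonexp step_le l)) _.
rewrite PE natrM -!natr1; set y := k%:R + 1; set z := l%:R + 1.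
have y_gt0 : 0 < y by rewrite ltr_wpDl.
have z_gt0 : 0 < z by rewrite ltr_wpDl.
have -> : l%:R = z - 1 by rewrite addrK.
clearbody y z.
by rewrite le_eqVlt; apply/orP; left; apply/eqP; field; rewrite !gt_eqF.
Qed.

(** * The two rate functions measured against the thresholds *)

(** Each entry of the maximum supplies one threshold: the first [N_ge], the second [n_ge], the third
    [qn]. *)
Lemma PhiStar_le (R : realType) (gamma : R) (gamma_gt0 : 0 < gamma)
    (gamma_le1 : gamma <= 1) (b K l j : nat) (JE : J gamma = j%:Z)
    (gj_ge1 : 1 <= gamma * j%:R)
    (gj_le : gamma * j%:R <= 1 + gamma)
    (b_gt0 : (0 < b)%N) (K_gt0 : (0 < K)%N) (l_gt0 : (0 < l)%N) (k n : nat)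
    (P : R) (PE : P = (l.+1 * k.+1)%:R) :
  PhiStar gamma b K l k <= n%:Z ->
  [/\ (j * b - j - 1 <= n)%N,
      4 * K%:R * P * (K%:R * P * ((b%:R + 1) / gamma * l%:R))
        <= (n + l + j)%:R
    & (b%:R + 1) * K%:R * P <= gamma * (n.+1 + j)%:R].
Proof.
rewrite /PhiStar !ge_max JE (Q_natE JE b_gt0) => /and3P[h1 h2 h3].
have K_ge1 : 1 <= K%:R :> R by rewrite ler1n.
have b_ge1 : 1 <= b%:R :> R by rewrite ler1n.
have l_ge1 : 1 <= l%:R :> R by rewrite ler1n.
have P_ge2 : 2 <= P by rewrite PE ler_nat (@leq_mul 2 1).
have PE' : P = (l%:R + 1) * (k%:R + 1) by rewrite PE natrM -!natr1.
split; first by clear -h3; lia.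
- have q_le : (j * b - j - 1)%:R <= j%:R * (b%:R - 1) :> R.
    rewrite mulrBr mulr1 -natrM -natrB ?leq_pmulr // ler_nat; exact: leq_subr.
  move: h1; rewrite /psi JE (Q_natE JE b_gt0).
  set C := Num.ceil _; set q := (j * b - j - 1)%N in q_le *.
  set lb := _ - q%:Z - 1; set m := Num.max lb 0.
  have m_ge : lb <= m by rewrite le_max lexx.
  clearbody m; rewrite -(ler_int R) => h1; rewrite -(ler_int R) /lb in m_ge.
  move: m_ge h1; rewrite !(rmorphB, rmorphD, rmorphM) /= -!pmulrn.
  have : (b%:R + 1) * K%:R / gamma <= C%:~R by exact: ceil_ge.
  rewrite mulrAC; move: (C%:~R) (m%:~R) => C' m' C_ge m_ge h1.
  (* The argument of [psi] plus one is 2P, so [psi] + J - 1 is at least 2KPcl - (q + 2). One of the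
     two copies of KPcl absorbs q + 2 <= 2c. *)
  have : q%:R + 2 <= 2 * ((b%:R + 1) / gamma).
    rewrite mulrA ler_pdivlMr //; nra.
  move: C_ge; move: (_ / gamma) => c C_ge c_ge.
  have q_ge0 : 0 <= q%:R :> R by [].
  have Pl_ge2 : 2 <= P * l%:R by nra.
  have KPl_ge2 : 2 <= K%:R * (P * l%:R) by nra.
  have PlC : P * l%:R * (c * K%:R) <= P * l%:R * C' by rewrite ler_wpM2l //; lra.
  have qc : 2 * c <= K%:R * (P * l%:R) * c by rewrite ler_wpM2r //; lra.
  have mE : l%:R * C' * (2 * P) - j%:R - q%:R - 1 <= m' by rewrite PE'; lra.
  have X_le : K%:R * P * (c * l%:R) <= m' + j%:R - 1 by lra.
  have KP4 : 0 <= 4 * K%:R * P by rewrite !mulr_ge0 //; lra.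
  apply: le_trans (ler_wpM2l KP4 X_le) _.
  have -> : 4 * K%:R * P * (m' + j%:R - 1)
      = 4 * K%:R * (l%:R + 1) * (k%:R + 1) * (m' + j%:R - 1) by rewrite PE'; ring.
  lra.
move: h2; rewrite -(ler_int R) !(rmorphB, rmorphD, rmorphM) /= -!pmulrn => h2.
rewrite natrD -natr1.
have W_ge0 : 0 <= (b%:R + 1) * K%:R * P by rewrite !mulr_ge0 //; lra.
have jW : j%:R * ((b%:R + 1) * K%:R * P) <= n%:R + 1 + j%:R by rewrite PE'; lra.
by have := ler_wpM2l (ltW gamma_gt0) jW; nra.
Qed.

(** With V = l j (b+1) K P >= 1, the inner factor 2V - 1 is at least V; this product form serves
    both nonnegativity and the thresholds. *)
Lemma PhiTildeStar_ge (R : realType) (gamma : R)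
    (b K l j : nat) (JE : J gamma = j%:Z) (j_gt0 : (0 < j)%N)
    (K_gt0 : (0 < K)%N) (l_gt0 : (0 < l)%N) (k : nat)
    (P : R) (PE : P = (l.+1 * k.+1)%:R) :
  4 * (K%:R * P) * (l%:R * j%:R * ((b%:R + 1) * K%:R * P)) - j%:R
    <= (PhiTildeStar gamma b K l k)%:~R.
Proof.
rewrite /PhiTildeStar JE !(rmorphB, rmorphD, rmorphM) /= -!pmulrn.
have PE' : P = (l%:R + 1) * (k%:R + 1) by rewrite PE natrM -!natr1.
have K_ge1 : 1 <= K%:R :> R by rewrite ler1n.
have l_ge1 : 1 <= l%:R :> R by rewrite ler1n.
have j_ge1 : 1 <= j%:R :> R by rewrite ler1n.
have P_ge1 : 1 <= P by rewrite PE ler1n.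
have KP_ge1 : 1 <= K%:R * P by nra.
have W_ge1 : 1 <= (b%:R + 1) * K%:R * P.
  by rewrite -mulrA; have : 0 <= b%:R :> R by []; nra.
have lj_ge1 : 1 <= l%:R * j%:R :> R by nra.
have V_ge1 : 1 <= l%:R * j%:R * ((b%:R + 1) * K%:R * P) by nra.
have KP4 : 0 <= 4 * (K%:R * P) by lra.
have h : l%:R * j%:R * ((b%:R + 1) * K%:R * P)
    <= 2 * (l%:R * j%:R * ((b%:R + 1) * K%:R * P)) - 1 by lra.
rewrite lerD2r; apply: le_trans (ler_wpM2l KP4 h) _.
by rewrite PE' le_eqVlt; apply/orP; left; apply/eqP; ring.
Qed.

Lemma PhiTildeStar_le (R : realType) (gamma : R) (gamma_gt0 : 0 < gamma)
    (b K l j : nat) (JE : J gamma = j%:Z)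
    (j_gt0 : (0 < j)%N) (gj_ge1 : 1 <= gamma * j%:R)
    (b_gt0 : (0 < b)%N) (K_gt0 : (0 < K)%N) (l_gt0 : (0 < l)%N) (k n : nat)
    (P : R) (PE : P = (l.+1 * k.+1)%:R) :
  PhiTildeStar gamma b K l k <= n%:Z ->
  [/\ (j * b - j - 1 <= n)%N,
      4 * K%:R * P * (K%:R * P * ((b%:R + 1) / gamma * l%:R))
        <= (n + l + j)%:R
    & (b%:R + 1) * K%:R * P <= gamma * (n.+1 + j)%:R].
Proof.
rewrite -(ler_int R) => /(le_trans (PhiTildeStar_ge b JE j_gt0 K_gt0 l_gt0 PE)).
rewrite -pmulrn => h.
have K_ge1 : 1 <= K%:R :> R by rewrite ler1n.
have b_ge1 : 1 <= b%:R :> R by rewrite ler1n.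
have l_ge1 : 1 <= l%:R :> R by rewrite ler1n.
have j_ge1 : 1 <= j%:R :> R by rewrite ler1n.
have P_ge1 : 1 <= P by rewrite PE ler1n.
have KP_ge1 : 1 <= K%:R * P by nra.
have W_ge0 : 0 <= (b%:R + 1) * K%:R * P by rewrite !mulr_ge0 //; lra.
have jW_ge0 : 0 <= j%:R * ((b%:R + 1) * K%:R * P) by rewrite mulr_ge0.
have ljW : j%:R * ((b%:R + 1) * K%:R * P)
    <= l%:R * j%:R * ((b%:R + 1) * K%:R * P) by rewrite -[leRHS]mulrA ler_peMl.
(* Dropping the factors l and 4KP, both at least 1, leaves a bound that suffices for the first and
   third thresholds. *)
have jW : j%:R * ((b%:R + 1) * K%:R * P) <= n%:R + j%:R.
  rewrite -lerBlDr; apply: le_trans h; rewrite lerD2r.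
  by apply: (le_trans ljW); apply: ler_peMl; [exact: le_trans ljW | lra].
split.
- have : (j * b)%:R <= (n + j)%:R :> R.
    rewrite natrD natrM; apply: le_trans jW; rewrite ler_wpM2l //.
    by rewrite -mulrA; nra.
  by rewrite ler_nat; clear; lia.
(* Since gamma j >= 1, the integer j replaces 1/gamma from above. *)
- have c_le : (b%:R + 1) / gamma <= j%:R * (b%:R + 1).
    by rewrite ler_pdivrMr // mulrAC mulrC ler_peMr ?[_ * gamma]mulrC //; lra.
  move: c_le; move: (_ / gamma) => c c_le.
  have KPl_ge0 : 0 <= 4 * (K%:R * P) * (K%:R * P * l%:R).
    by rewrite !mulr_ge0 //; lra.
  have := ler_wpM2l KPl_ge0 c_le => h'.
  have l_ge0 : 0 <= l%:R :> R by [].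
  rewrite !natrD.
  have -> : 4 * K%:R * P * (K%:R * P * (c * l%:R))
      = 4 * (K%:R * P) * (K%:R * P * l%:R) * c by ring.
  by move: h'; lra.
- rewrite natrD -natr1.
  have := ler_wpM2l (ltW gamma_gt0) jW.
  have : (b%:R + 1) * K%:R * P <= gamma * j%:R * ((b%:R + 1) * K%:R * P).
    by rewrite ler_peMl.
  lra.
Qed.

Lemma PhiStar_ge0 (R : realType) (gamma : R) (b K l k : nat) :
  0 <= PhiStar gamma b K l k.
Proof. by rewrite /PhiStar !le_max; apply/orP; right; apply/orP; right; lia. Qed.

(** The subtracted j is itself a factor of the product in the lower bound. *)
Lemma PhiTildeStar_ge0 (R : realType) (gamma : R)
    (b K l j : nat) (JE : J gamma = j%:Z) (j_gt0 : (0 < j)%N)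
    (K_gt0 : (0 < K)%N) (l_gt0 : (0 < l)%N) (k : nat) :
  0 <= PhiTildeStar gamma b K l k.
Proof.
rewrite -(ler_int R); apply: le_trans (PhiTildeStar_ge b JE j_gt0 K_gt0 l_gt0 erefl).
rewrite subr_ge0.
have P_gt0 : (0 < l.+1 * k.+1)%N by [].
have -> : 4 * (K%:R * (l.+1 * k.+1)%:R)
    * (l%:R * j%:R * ((b%:R + 1) * K%:R * (l.+1 * k.+1)%:R))
  = (4 * (K * (l.+1 * k.+1)) * (l * j * (b.+1 * K * (l.+1 * k.+1))))%:R :> R.
  by rewrite !natrM -[b.+1%:R]natr1.
rewrite ler_nat mulnCA [(l * j)%N]mulnC -!mulnA leq_pmulr //.
by rewrite !muln_gt0 K_gt0 l_gt0.
Qed.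

(** * From the thresholds to the two rates *)

Theorem proposition11
  (R : realType) (H : completeNormedModType R)
  (dot : {dot H for (@idfun R)}) (hdot : dot_induces_norm dot)
  (A : {linear H -> H}) (A_bounded : bounded_near A (nbhs (0 : H)))
  (A_selfadj : self_adjoint dot A)
  (gamma : R) (gamma_gt0 : 0 < gamma) (gamma_le1 : gamma <= 1)
  (A_coercive : forall x : H, gamma * `|x| ^+ 2 <= dot (A x) x)
  (l : nat) (l_ge1 : (1 <= l)%N)
  (T : nat -> H -> H)
  (T_nonexp : forall i : nat, (i < l)%N -> nonexpansive (T i))
  (T_periodic : forall n : nat, (l <= n)%N -> T n = T (n %% l)%N)
  (u : H) (x : nat -> H) (x_xu : xu_iteration A T u (alpha gamma) x)
  (p : H) (p_fix : (\bigcap_(i < l) Fix (T i)) p)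
  (bA : nat) (bA_ge1 : (1 <= bA)%N) (bA_norm : opnorm A <= bA%:R)
  (K : nat) (K_ge1 : (1 <= K)%N)
  (K_bound : Num.max `|x (Q gamma bA) - p| (`|u - A p| / gamma) <= K%:R) :
  ((forall k : nat, 0 <= PhiStar gamma bA K l k) /\
   asymptotic_regularity_rate (Ttilde T l) x
     (fun k => `|PhiStar gamma bA K l k|%N)) /\
  ((forall k : nat, 0 <= PhiTildeStar gamma bA K l k) /\
   asymptotic_regularity_rate (Ttilde T l) x
     (fun k => `|PhiTildeStar gamma bA K l k|%N)).
Proof.
have [j [JE j_gt0 gj_ge1 gj_le]] := J_natE gamma_gt0 gamma_le1.
have Q_E := Q_natE JE bA_ge1.
have b_gt0 : 0 < bA%:R :> R by rewrite ltr0n.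
have A_le (z : H) : `|A z| <= bA%:R * `|z|.
  by apply: le_trans (le_opnorm A_bounded z) _; rewrite ler_wpM2r.
have contr := norm_I_sub_scale_le hdot A_selfadj A_coercive b_gt0 A_le.
(* Reduction modulo l carries nonexpansiveness and the fixed point p from the first l maps to all
   indices. *)
have T_mod i : T i = T (i %% l)%N.
  by case: (ltnP i l) => [il|li]; [rewrite modn_small | rewrite -T_periodic].
have T_per i : T (i + l)%N = T i by rewrite T_mod modnDr -T_mod.
have T_ne i : nonexpansive (T i) by rewrite T_mod; apply: T_nonexp; rewrite ltn_pmod.
have T_fix i : T i p = p by rewrite T_mod; apply: p_fix; rewrite /= ltn_pmod.
have alphaE i : alpha gamma i = (gamma * (i + j)%:R)^-1.
  by rewrite /alpha JE -pmulrn natrD mul1r.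
have x_xu' : xu_iteration A T u (fun n => (gamma * (n + j)%:R)^-1) x.
  by move=> n; rewrite x_xu alphaE.
move: K_bound; rewrite ge_max Q_E => /andP[xq_le].
rewrite ler_pdivrMr // mulrC => u_le.
have core := xu_rate_core gamma_gt0 gamma_le1 bA_ge1 A_le contr l_ge1 T_ne T_per
  T_fix j_gt0 gj_ge1 gj_le x_xu' K_ge1 xq_le u_le.
split; split=> [k|k n].
- exact: PhiStar_ge0.
(* Nonnegativity makes the absolute value a plain cast, so the hypothesis on n becomes an integer
   inequality. *)
- rewrite -lez_nat gez0_abs ?PhiStar_ge0 //.
  case/(PhiStar_le gamma_gt0 gamma_le1 JE gj_ge1 gj_le bA_ge1 K_ge1 l_ge1
    erefl) => qn N_ge n_ge.
  exact: core erefl qn N_ge n_ge.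
- exact: (PhiTildeStar_ge0 bA JE).
- rewrite -lez_nat gez0_abs ?(PhiTildeStar_ge0 bA JE) //.
  case/(PhiTildeStar_le gamma_gt0 JE j_gt0 gj_ge1 bA_ge1 K_ge1 l_ge1
    erefl) => qn N_ge n_ge.
  exact: core erefl qn N_ge n_ge.
Qed.
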